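(* There is an infinite family of asymptotically good simply-symmetric LDPC (binary linear) error correcting codes.
   Context: A (binary linear) code is a subspace $C\subseteq\mathbb{F}_2^X$ for a finite set $X$; its length is $|X|$, its rate is $\dim C/|X|$ and its normalized distance is the minimum Hamming weight of a nonzero codeword divided by $|X|$. A set of defining constraints of $C$ is a spanning set of the dual code $C^{\perp}=\{y\in\mathbb{F}_2^X:\sum_{x\in X}y(x)c(x)=0\ \forall c\in C\}$; codes are considered together with a specified set of defining constraints. A family of codes is LDPC if the defining constraints of all codes in the family have Hamming weight bounded by a common constant. A family of codes is asymptotically good if the lengths tend to infinity and both the rates and the normalized distances are bounded below by a positive constant. A code $C\subseteq\mathbb{F}_2^X$ is simply-symmetric with respect to a group $G$ if there is a simply transitive action of $G$ on $X$ such that the induced coordinate-permuting action of $G$ on $\mathbb{F}_2^X$ preserves $C$; a code is simply-symmetric if it is simply-symmetric with respect to some group. *)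

(* Defs.v *)
From HB Require Import structures.
From mathcomp Require Import all_boot all_order all_algebra all_fingroup.

Set Implicit Arguments.
Unset Strict Implicit.
Unset Printing Implicit Defensive.

Import Order.TTheory GRing.Theory Num.Theory.
Local Open Scope ring_scope.

(* [('F_2)^o] is ['F_2] seen as a vector space over itself; this is what gives
   [word X] its canonical ['F_2]-vector space structure. *)
Notation word X := {ffun X -> ('F_2)^o}.

Section Words.
Variable X : finType.
Implicit Types (c y : word X) (C : {vspace word X}) (H : {set word X}).

Definition weight c : nat := #|[set x | c x != 0]|.

Definition dot y c : 'F_2 := \sum_x (y x : 'F_2) * c x.

Definition dual_code C : {set word X} :=
  [set y | [forall c in C, dot y c == 0]].

Definition defining_constraints C H : Prop :=
  [set y in <<enum H>>%VS] = dual_code C.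

(* The default value [#|X|] bounds every weight, so it is attained as the
   minimum only by an actual codeword, or when [C] is the zero code. *)
Definition min_weight C : nat :=
  \big[minn/#|X|]_(c : word X | (c \in C) && (c != 0)) weight c.

Definition rate C : rat := (\dim C)%:R / #|X|%:R.

Definition normalized_distance C : rat := (min_weight C)%:R / #|X|%:R.

Definition simply_transitive (gT : finGroupType) (to : {action gT &-> X}) :=
  [transitive [set: gT], on [set: X] | to]
  /\ forall x : X, 'C[x | to]%g = 1%g.

(* Actions are right actions here, so the induced action on words moves the
   coordinate at [x] to the coordinate at [to x g]. *)
Definition permute_word (gT : finGroupType) (to : {action gT &-> X})
    (g : gT) c : word X :=
  [ffun x => c (to x g^-1%g)].

(* Finite groups suffice: a group acting simply transitively on the finite
   set [X] has [#|X|] elements. *)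
Definition simply_symmetric_wrt (gT : finGroupType) C : Prop :=
  exists to : {action gT &-> X}, simply_transitive to
    /\ forall (g : gT) c, c \in C -> permute_word to g c \in C.

Definition simply_symmetric C : Prop :=
  exists gT : finGroupType, simply_symmetric_wrt gT C.

End Words.

Record code := Code {
  coords : finType;
  codewords :> {vspace word coords};
  constraints : {set word coords};
  constraintsP : defining_constraints codewords constraints
}.

Definition code_length (C : code) : nat := #|coords C|.

Definition LDPC (F : nat -> code) : Prop :=
  exists w : nat, forall n (y : word (coords (F n))),
    y \in constraints (F n) -> (weight y <= w)%N.

Definition asymptotically_good (F : nat -> code) : Prop :=
  (forall N : nat, exists n0 : nat, forall n : nat,
     (n0 <= n)%N -> (N <= code_length (F n))%N)
  /\ exists2 eps : rat, 0 < eps &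
       forall n : nat, eps <= rate (F n) /\ eps <= normalized_distance (F n).

(* Main.v *)
(** Let [q = 2 ^ 64] and let [G] be generated by three copies [X_0, X_1, X_2] of
    the additive group of [F_q], realised as elementary matrices such that any
    two of them generate a Heisenberg group of order [q ^ 3]. The codewords are
    the functions on [G] whose restriction to every left coset of every [X_i] is
    a codeword of an extended BCH code. Left translation acts simply
    transitively, and counting the checks bounds the rate from below.

    For the distance, let [P_H] be the averaging projection onto the functions
    invariant under [H]. In a Heisenberg group
    [P_X P_Y P_X = q^-1 P_X (1 - P_Z) + P_<X, Y>], so distinct [X_i] and [X_j]
    are nearly orthogonal. With [D = (1 - P_0) + (1 - P_1) + (1 - P_2)] this
    gives [D ^ 2 >= (1 - 2 / sqrt q) D], a spectral gap independent of [G], by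
    which [<X_0, X_1>] and [X_2] are nearly orthogonal as well. An expander
    mixing argument then turns a lower bound for the density of the support of
    a codeword on the cosets of [X_i] first into one on the cosets of
    [<X_0, X_1>], and then into one on [G]. *)
From HB Require Import structures.
Require Import Defs.
From mathcomp Require Import all_boot all_order all_algebra all_fingroup.
From mathcomp Require Import finfield.
From mathcomp Require Import zify ring lra.

Set Implicit Arguments.
Unset Strict Implicit.
Unset Printing Implicit Defensive.

Import Order.TTheory GRing.Theory Num.Theory.
Local Open Scope ring_scope.

(** * Inner products and projections *)

Section Pairing.
Variables (K : fieldType) (T : finType).
Implicit Types u v w : {ffun T -> K^o}.

Definition ip u v : K := \sum_x (u x : K) * v x.

Lemma ipC u v : ip u v = ip v u.
Proof. by apply: eq_bigr => x _; rewrite mulrC. Qed.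

Lemma ipDl u v w : ip (u + v) w = ip u w + ip v w.
Proof. by rewrite -big_split; apply: eq_bigr => x _; rewrite ffunE mulrDl. Qed.

Lemma ipDr u v w : ip w (u + v) = ip w u + ip w v.
Proof. by rewrite ipC ipDl !(ipC w). Qed.

Lemma ipNl u v : ip (- u) v = - ip u v.
Proof. by rewrite /ip -sumrN; apply: eq_bigr => x _; rewrite ffunE mulNr. Qed.

Lemma ipNr u v : ip u (- v) = - ip u v.
Proof. by rewrite ipC ipNl ipC. Qed.

Lemma ipZl a u v : ip (a *: u) v = a * ip u v.
Proof.
by rewrite /ip mulr_sumr; apply: eq_bigr => x _; rewrite ffunE -mulrA.
Qed.

Lemma ipZr a u v : ip u (a *: v) = a * ip u v.
Proof. by rewrite ipC ipZl ipC. Qed.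

Lemma ip0l v : ip 0 v = 0.
Proof. by apply: big1 => x _; rewrite ffunE mul0r. Qed.

Definition ipE := (ipDl, ipDr, ipNl, ipNr, ipZl, ipZr).

(** Taking orthogonal complements twice gives back the span over any field, without positivity: the
    cokernel of the matrix of [hs] lists vectors orthogonal to [hs], and what they annihilate is its
    row space. This serves over ['F_2] for dual codes and over ordered fields for images of
    operators. *)
Lemma span_perp (hs : seq {ffun T -> K^o}) u :
  (forall v, (forall h, h \in hs -> ip h v = 0) -> ip u v = 0) ->
  u \in <<hs>>%VS.
Proof.
move=> uP.
pose row v : 'rV[K]_#|T| := \row_j v (enum_val j).
pose M := \matrix_(i < size hs) row hs`_i.
have ip_mx w n (B : 'M_(#|T|, n)) j :
    (row w *m B) 0 j = ip w [ffun x => B (enum_rank x) j].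
  rewrite mxE /ip [RHS](reindex _ (onW_bij _ (@enum_val_bij T))) /=.
  by apply: eq_bigr => i _; rewrite mxE ffunE enum_valK.
have: (row u <= M)%MS.
  rewrite submxE; apply/eqP/rowP => j; rewrite [RHS]mxE ip_mx.
  apply: uP => h /(nthP 0)[i lt_i <-]; rewrite -ip_mx.
  have := congr1 (fun B : 'M_(_, _) => B (Ordinal lt_i) j) (mulmx_coker M).
  rewrite [in X in _ = X -> _]mxE => <-; rewrite !mxE.
  by apply: eq_bigr => k _; rewrite !mxE.
case/submxP => D Du.
have ->: u = \sum_(i < size hs) D 0 i *: hs`_i.
  apply/ffunP => x; rewrite sum_ffunE.
  have := congr1 (fun w : 'rV_#|T| => w 0 (enum_rank x)) Du.
  rewrite !mxE enum_rankK => ->; apply: eq_bigr => i _.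
  by rewrite !ffunE !mxE enum_rankK.
by apply: memv_suml => i _; apply/memvZ/memv_span/mem_nth.
Qed.

End Pairing.

Section InnerProduct.
Variables (R : realFieldType) (T : finType).
Local Notation V := {ffun T -> R^o}.
Implicit Types u v w x y f : V.

Definition nrm u : R := ip u u.

Lemma nrm_ge0 u : 0 <= nrm u.
Proof. by apply: sumr_ge0 => x _; rewrite -expr2 sqr_ge0. Qed.

Lemma nrm_eq0 u : nrm u = 0 -> u = 0.
Proof.
move=> /eqP; rewrite psumr_eq0 => [/allP u0|x _]; last by rewrite -expr2 sqr_ge0.
apply/ffunP => x; rewrite ffunE; apply/eqP.
by have := u0 x (mem_index_enum x); rewrite mulf_eq0 orbb.
Qed.

Lemma cauchy_schwarz u v : ip u v ^+ 2 <= nrm u * nrm v.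
Proof.
have [/nrm_eq0->|v_neq0] := eqVneq (nrm v) 0.
  by rewrite /nrm ipC !ip0l expr0n mulr0.
have v_gt0 : 0 < nrm v by rewrite lt_def v_neq0 nrm_ge0.
have := nrm_ge0 (nrm v *: u - ip u v *: v).
rewrite /nrm !ipE (ipC v u) -!/(nrm _) => uv_ge0.
rewrite -subr_ge0 -(pmulr_rge0 _ v_gt0); nra.
Qed.

Record projection (p : V -> V) := Projection {
  projP : forall a u v, p (a *: u + v) = a *: p u + p v;
  proj_sym : forall u v, ip (p u) v = ip u (p v);
  proj_id : forall u, p (p u) = p u
}.

Section Projection.
Variables (p : V -> V) (pP : projection p).

Lemma projB u v : p (u - v) = p u - p v.
Proof. by rewrite addrC -scaleN1r (projP pP) scaleN1r addrC. Qed.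

Lemma ip_proj u v : ip (p u) (p v) = ip u (p v).
Proof. by rewrite (proj_sym pP) (proj_id pP). Qed.

Lemma ip_projC u v : ip (u - p u) (v - p v) = ip u (v - p v).
Proof. by rewrite !ipE !(ip_proj, proj_sym pP, proj_id pP); ring. Qed.

Lemma nrm_projC u : nrm (u - p u) = nrm u - nrm (p u).
Proof. by rewrite {1}/nrm ip_projC !ipE -ip_proj. Qed.

End Projection.

(** In the applications [s] projects onto the intersection of the ranges of [p] and [r], so [eta]
    bounds the squared cosine of the angle between these ranges modulo their intersection. *)
Definition near_orthogonal (p r s : V -> V) (eta : R) :=
  forall f, p f = f -> s f = 0 -> nrm (r f) <= eta * nrm f.

(* On the kernel of [s] the hypothesis gives [p + r <= 1 + eps], so that
   [(1 + eps - (p + r)) (2 - (p + r))] is nonnegative; expanding this product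
   yields the claim. *)
Lemma near_orthogonal_compl (p r s : V -> V) (eps : R) x :
    projection p -> projection r -> projection s ->
    (forall u, p (s u) = s u) -> (forall u, r (s u) = s u) ->
    0 <= eps <= 1 -> near_orthogonal p r s (eps ^+ 2) ->
  0 <= 2 * ip (x - p x) (x - r x) + eps * (nrm (x - p x) + nrm (x - r x)).
Proof.
move=> pP rP sP ps rs /andP[eps0 eps1] pr.
pose y := x - s x.
have -> : x - p x = y - p y.
  by rewrite /y (projB pP) ps opprB addrA subrK.
have -> : x - r x = y - r y.
  by rewrite /y (projB rP) rs opprB addrA subrK.
have sy : s y = 0 by rewrite /y (projB sP) (proj_id sP) subrr.
have spy : s (p y) = 0.
  apply: nrm_eq0; rewrite /nrm (ip_proj sP) (proj_sym pP) ps.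
  by rewrite -(proj_sym sP) sy ip0l.
clearbody y => {x sy}.
have hc : ip (p y) (r y) ^+ 2 <= eps ^+ 2 * nrm (p y) * nrm (r y).
  rewrite -(ip_proj rP) (le_trans (cauchy_schwarz _ _)) //.
  by rewrite ler_wpM2r ?nrm_ge0 ?pr // (proj_id pP).
have ya : ip y (p y) = nrm (p y) by rewrite -(ip_proj pP).
have yb : ip y (r y) = nrm (r y) by rewrite -(ip_proj rP).
have [hn hcs] := (nrm_ge0 ((1 + eps) *: y - (p y + r y)),
                  cauchy_schwarz y (p y + r y)).
move: hn hcs; rewrite (nrm_projC pP) (nrm_projC rP).
rewrite /nrm !ipE (ipC (p y) y) (ipC (r y) y) (ipC (r y) (p y)) ya yb -!/(nrm _).
move: hc (nrm_ge0 y) (nrm_ge0 (p y)) (nrm_ge0 (r y)).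
move: (nrm y) (nrm (p y)) (nrm (r y)) (ip (p y) (r y)) => n a b c.
move=> hc n0 a0 b0 hn hcs.
have c_le : 2 * c <= eps * (a + b).
  rewrite (le_trans (ler_norm _)) // -(ler_pXn2r (n := 2)) ?nnegrE //; last first.
    by rewrite mulr_ge0 ?addr_ge0.
  rewrite real_normK ?num_real //.
  have : 0 <= eps ^+ 2 * (a - b) ^+ 2 by rewrite mulr_ge0 ?sqr_ge0.
  by move: hc; nra.
(* Here [a + b] is the inner product of [y] with [p y + r y], so Cauchy-Schwarz gives
   [(a + b) ^+ 2 <= n * (a + b + 2 * c)]. *)
have ab_le : a + b <= (1 + eps) * n.
  have [ab0|ab0] := leP (a + b) 0; first by nra.
  rewrite -(ler_pM2l ab0) (le_trans (y := n * (a + b + 2 * c))) //; nra.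
have : 0 <= (1 - eps) * ((1 + eps) * n - (a + b)).
  by rewrite mulr_ge0 ?subr_ge0.
by lra.
Qed.

(** * Spectral gap of three pairwise nearly orthogonal projections *)

Section ThreeProjections.
Variables (p1 p2 p3 : V -> V) (eps : R).
Hypotheses (p1P : projection p1) (p2P : projection p2) (p3P : projection p3).
Hypothesis eps_le : 2 * eps <= 1.

Local Notation angle p r := (forall x,
  0 <= 2 * ip (x - p x) (x - r x) + eps * (nrm (x - p x) + nrm (x - r x))).
Hypotheses (a12 : angle p1 p2) (a23 : angle p2 p3) (a31 : angle p3 p1).

Definition laplacian x := (x - p1 x) + (x - p2 x) + (x - p3 x).

Definition energy x := nrm (x - p1 x) + nrm (x - p2 x) + nrm (x - p3 x).

(** Each of the three norms occurs in two of the bounds for the cross terms of [nrm (laplacian x)],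
    whence the loss of [2 * eps]. *)
Lemma energy_le x : (1 - 2 * eps) * energy x <= nrm (laplacian x).
Proof.
move: (a12 x) (a23 x) (a31 x); rewrite /energy /laplacian.
move: (x - p1 x) (x - p2 x) (x - p3 x) => u v w.
by rewrite /nrm !ipE (ipC v u) (ipC w v) (ipC u w); lra.
Qed.

(** As [energy] is the quadratic form of [D = laplacian], [energy_le] says [D ^ 2 >= c D]. That this
    forces [D >= c] on the image of [D] is derived without eigenvalues. *)
Lemma spectral_gap y :
  (1 - 2 * eps) * nrm (laplacian y) <= energy (laplacian y).
Proof.
set c := 1 - 2 * eps; set x := laplacian y.
have xx : nrm x = ip (x - p1 x) (y - p1 y) + ip (x - p2 x) (y - p2 y)
                  + ip (x - p3 x) (y - p3 y).
  by rewrite (ip_projC p1P) (ip_projC p2P) (ip_projC p3P) -!ipDr.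
(* Expand [0 <= energy (x - c *: y)]. *)
have := energy_le y; rewrite -/c -/x.
have : 0 <= c by rewrite subr_ge0.
have := nrm_ge0 ((x - p1 x) - c *: (y - p1 y)).
have := nrm_ge0 ((x - p2 x) - c *: (y - p2 y)).
have := nrm_ge0 ((x - p3 x) - c *: (y - p3 y)).
move: xx; rewrite /energy; set n := nrm x.
move: (x - p1 x) (x - p2 x) (x - p3 x) (y - p1 y) (y - p2 y) (y - p3 y).
move=> u v w u' v' w'; rewrite /nrm !ipE (ipC u' u) (ipC v' v) (ipC w' w).
clearbody n c => xx hw hv hu c0 hy.
have : 0 <= c * (n - c * (ip u' u' + ip v' v' + ip w' w')).
  by rewrite mulr_ge0 // subr_ge0.
by move: hw hv hu; rewrite xx; lra.
Qed.

Lemma laplacian_sym u v : ip (laplacian u) v = ip u (laplacian v).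
Proof.
rewrite /laplacian !ipE.
by rewrite (proj_sym p1P) (proj_sym p2P) (proj_sym p3P).
Qed.

Lemma laplacian_eq0 v : laplacian v = 0 -> [/\ p1 v = v, p2 v = v & p3 v = v].
Proof.
move=> v0; have : energy v = ip (laplacian v) v.
  rewrite /energy /laplacian /nrm (ip_projC p1P) (ip_projC p2P) (ip_projC p3P).
  by rewrite 2!ipDl; congr (_ + _ + _); apply: ipC.
rewrite v0 ip0l /energy => e0.
have [[n1 n2] n3] := (nrm_ge0 (v - p1 v), nrm_ge0 (v - p2 v), nrm_ge0 (v - p3 v)).
by split; apply/esym/eqP; rewrite -subr_eq0; apply/eqP/nrm_eq0; lra.
Qed.

Lemma laplacianP a u v : laplacian (a *: u + v) = a *: laplacian u + laplacian v.
Proof.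
rewrite /laplacian (projP p1P) (projP p2P) (projP p3P).
by apply/ffunP => x; rewrite !ffunE /GRing.scale /=; ring.
Qed.

(** The image of a symmetric operator is the orthogonal complement of its kernel; it is spanned by
    the images of the point masses [e z]. *)
Lemma laplacian_image f :
  (forall v, laplacian v = 0 -> ip f v = 0) -> exists y, laplacian y = f.
Proof.
move=> fP; pose e z : V := [ffun x => (x == z)%:R].
have ipe z v : ip (e z) v = v z.
  rewrite /ip (bigD1 z) //= ffunE eqxx mul1r big1 ?addr0 // => x /negbTE x_z.
  by rewrite ffunE x_z mul0r.
have: f \in <<[seq laplacian (e z) | z <- enum T]>>%VS.
  apply: span_perp => v vP; apply: fP; apply/ffunP => z.
  rewrite [RHS]ffunE -ipe -laplacian_sym; apply: vP.
  by apply: map_f; rewrite mem_enum.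
move/(@coord_span _ _ _ (in_tuple _)) => ->.
elim/big_rec: _ => [|i _ _ [y <-]].
  exists 0; have := laplacianP (-1) 0 0.
  by rewrite !scaleN1r oppr0 addr0 addNr => ->.
have /mapP[z _ ->] := mem_nth 0 (ltn_ord i).
by rewrite -laplacianP; eexists.
Qed.

(** For [f] fixed by [p1] and [p2] only the term [nrm (f - p3 f)] of the energy survives, and the
    gap bounds it from below. *)
Lemma image_gap f y : laplacian y = f -> p1 f = f -> p2 f = f ->
  nrm (p3 f) <= 2 * eps * nrm f.
Proof.
move=> <- f1 f2; have := spectral_gap y; rewrite /energy f1 f2.
by rewrite (nrm_projC p3P) !subrr {2 3}/nrm !ip0l; lra.
Qed.

End ThreeProjections.

End InnerProduct.

(** * Averaging over subgroups *)

Section Averages.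
Variables (R : realFieldType) (gT : finGroupType).
Local Notation V := {ffun gT -> R^o}.
Implicit Types (f u v : V) (H K L : {group gT}).

(** Averaging is over right multiplication, so for a subgroup the fixed functions are those constant
    on its left cosets. *)
Definition avg (A : {set gT}) f : V :=
  [ffun g => #|A|%:R^-1 * (\sum_(h in A) (f (g * h)%g : R))].

Lemma card_group_neq0 H : #|H|%:R != 0 :> R.
Proof. by rewrite pnatr_eq0 -lt0n cardG_gt0. Qed.

Lemma avg_mulr H f g h : h \in H -> avg H f (g * h)%g = avg H f g.
Proof.
move=> Hh; rewrite !ffunE; congr (_ * _).
rewrite (reindex_inj (mulgI h^-1%g)) /=; apply: eq_big => k.
  by rewrite groupMl ?groupV.
by move=> _; rewrite mulgA mulgK.
Qed.

Lemma avg_fix H f : (forall g h, h \in H -> f (g * h)%g = f g) -> avg H f = f.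
Proof.
move=> fH; apply/ffunP => g; rewrite ffunE.
rewrite (eq_bigr (fun=> f g : R)) => [|h /fH->//].
rewrite sumr_const -[X in _ * X]/((f g : R) *+ _) -(mulr_natl (f g : R)).
by rewrite mulKf // card_group_neq0.
Qed.

Lemma avg_fixP H f g h : avg H f = f -> h \in H -> f (g * h)%g = f g.
Proof. by move=> <-; apply: avg_mulr. Qed.

Lemma avg_proj H : projection (avg H).
Proof.
split=> [a u v|u v|u]; last by apply: avg_fix => g h; apply: avg_mulr.
  apply/ffunP => g; rewrite !ffunE /GRing.scale /= mulrCA -mulrDr; congr (_ * _).
  by rewrite mulr_sumr -big_split; apply: eq_bigr => h _; rewrite !ffunE.
transitivity (#|H|%:R^-1 * \sum_(h in H) \sum_g u (g * h)%g * v g).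
  rewrite exchange_big mulr_sumr; apply: eq_bigr => g _.
  by rewrite ffunE -mulrA mulr_suml.
rewrite /ip; under [RHS]eq_bigr => g _ do rewrite ffunE mulrCA mulr_sumr.
rewrite -mulr_sumr [in RHS]exchange_big /=; congr (_ * _).
rewrite (reindex_inj invg_inj) /=.
apply: eq_big => h; first by rewrite groupV.
move=> _; rewrite (reindex_inj (mulIg h)) /=.
by apply: eq_bigr => g _; rewrite mulgK.
Qed.

Lemma avg_absorb H L f : H \subset L -> avg H (avg L f) = avg L f.
Proof. by move=> sHL; apply: avg_fix => g h /(subsetP sHL); apply: avg_mulr. Qed.

Lemma avg_absorbr H L f : H \subset L -> avg L (avg H f) = avg L f.
Proof.
move=> sHL; have [LP HP] := (avg_proj L, avg_proj H).
apply/eqP; rewrite -subr_eq0; apply/eqP/nrm_eq0.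
rewrite -(projB LP) /nrm (ip_proj LP) ipDl ipNl (proj_sym HP).
by rewrite avg_absorb // subrr.
Qed.

(** * Mixing and local density *)

Definition mixing H K L (eta : R) := near_orthogonal (avg H) (avg K) (avg L) eta.

(** Only cosets that meet [F] are constrained; for the whole group and nonempty [F] this bounds the
    density of [F]. *)
Definition dense (F : {set gT}) H (delta : R) :=
  forall g, g \in F -> delta * #|H|%:R <= #|F :&: (g *: H)%g|%:R.

Definition ind (A : {set gT}) : V := [ffun g => (g \in A)%:R].

Lemma ip_ind A B : ip (ind A) (ind B) = #|A :&: B|%:R.
Proof.
rewrite /ip -sum1_card natr_sum [RHS]big_mkcond; apply: eq_bigr => g _.
rewrite !ffunE inE; case: (g \in A); case: (g \in B);
  by rewrite /= ?(mul0r, mulr0, mulr1).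
Qed.

Lemma nrm_ind A : nrm (ind A) = #|A|%:R.
Proof. by rewrite /nrm ip_ind setIid. Qed.

Lemma sum_ind A : \sum_g (ind A g : R) = #|A|%:R.
Proof.
rewrite -nrm_ind; apply: eq_bigr => g _.
by rewrite ffunE; case: (g \in A); rewrite ?mulr1 ?mulr0.
Qed.

Lemma avg_ind (S : {set gT}) H : avg H (ind (S * H)%g) = ind (S * H)%g.
Proof.
apply: avg_fix => g h Hh; rewrite !ffunE; congr (nat_of_bool _)%:R.
have e : ((S * H) :* h = S * H)%g by rewrite -mulgA rcoset_id.
by rewrite -{1}e mem_rcoset mulgK.
Qed.

Lemma avg_ind_card (S : {set gT}) H g :
  avg H (ind S) g = #|H|%:R^-1 * #|S :&: (g *: H)%g|%:R.
Proof.
rewrite ffunE; congr (_ * _); rewrite -sum_ind [RHS](reindex_inj (mulgI g)) /=.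
rewrite big_mkcond; apply: eq_bigr => h _; rewrite !ffunE inE mem_lcoset mulKg.
by case: (h \in H); rewrite ?andbT ?andbF.
Qed.

Lemma ip_avg_le A B L :
  ip (avg L (ind A)) (ind B) <= #|A|%:R * #|B|%:R / #|L|%:R.
Proof.
rewrite -(sum_ind B) mulr_sumr mulr_suml; apply: ler_sum => g _.
rewrite mulrAC; apply: ler_wpM2r; first by rewrite ffunE ler0n.
rewrite avg_ind_card mulrC ler_wpM2r ?invr_ge0 ?ler0n // ler_nat.
exact: subset_leq_card (subsetIl _ _).
Qed.

(** [S * H] is a union of left cosets of [H], each of which meets [S] in all its points of [F],
    hence in a proportion of at least [delta]. *)
Lemma card_mul_dense F (S : {set gT}) H delta :
    dense F H delta -> S \subset F ->
    (forall s, s \in S -> F :&: (s *: H)%g \subset S) ->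
  delta * #|(S * H)%g|%:R <= #|S|%:R.
Proof.
move=> dF sSF SH.
apply: (@le_trans _ _ (ip (ind (S * H)%g) (avg H (ind S)))); last first.
  rewrite -(proj_sym (avg_proj H)) avg_ind ip_ind ler_nat.
  exact: subset_leq_card (subsetIr _ _).
rewrite -sum_ind mulr_sumr; apply: ler_sum => g _; rewrite mulrC ffunE.
have [/mulsgP[s h Ss Hh ->]|_] := boolP (g \in _); last by rewrite !mul0r.
rewrite !mul1r avg_ind_card mulrC ler_pdivlMr ?ltr0n ?cardG_gt0 //.
rewrite (le_trans (dF s (subsetP sSF _ Ss))) // ler_nat subset_leq_card //.
rewrite lcosetM (lcoset_id Hh) subsetI SH //=; exact: subsetIr.
Qed.

(** With [S] the part of [F] in one coset of [L], both [S * H] and [S * K] contain [S] and are not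
    much larger. Their intersection is a main term, at most the product of their sizes over [#|L|],
    plus an error controlled by [eta]; so [S] cannot be small. *)
Lemma mixing_dense F H K L dH dK eta :
    H \subset L -> K \subset L -> mixing H K L eta -> 0 <= eta ->
    0 < dH -> 0 < dK -> 4 * eta <= dH * dK -> dense F H dH -> dense F K dK ->
  dense F L (dH * dK / 2).
Proof.
move=> sHL sKL mix eta0 dH0 dK0 eta_le FH FK g gF.
set S := F :&: (g *: L)%g; have gS : g \in S by rewrite inE gF lcoset_refl.
have SF : S \subset F by apply: subsetIl.
have sub (M : {group gT}) s : M \subset L -> s \in S -> F :&: (s *: M)%g \subset S.
  move=> sML /setIP[_ /lcoset_eqP sg]; rewrite /S -sg.
  by apply/setIS/mulgS.
have hu := card_mul_dense FH SF (fun s => @sub H s sHL).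
have hv := card_mul_dense FK SF (fun s => @sub K s sKL).
pose u := ind (S * H)%g; pose v := ind (S * K)%g.
pose u0 := u - avg L u; have [LP KP] := (avg_proj L, avg_proj K).
have u0H : avg H u0 = u0.
  by rewrite (projB (avg_proj H)) avg_ind avg_absorb.
have u0L : avg L u0 = 0 by rewrite (projB LP) (proj_id LP) subrr.
have Nuv : #|S|%:R <= ip u v.
  rewrite ip_ind ler_nat subset_leq_card // subsetI.
  by rewrite !(subset_trans _ (mulg_subl _ _)) ?group1.
have c_le : ip u0 v ^+ 2 <= eta * (nrm u * nrm v).
  have -> : ip u0 v = ip (avg K u0) v by rewrite (proj_sym KP) avg_ind.
  rewrite (le_trans (cauchy_schwarz _ _)) // mulrA ler_wpM2r ?nrm_ge0 //.
  rewrite (le_trans (mix _ u0H u0L)) //.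
  by rewrite ler_wpM2l // (nrm_projC LP) gerBl nrm_ge0.
have N0 : 0 < #|S|%:R :> R by rewrite ltr0n; apply/card_gt0P; exists g.
have L0 : 0 < #|L|%:R :> R by rewrite ltr0n cardG_gt0.
have := ip_avg_le (S * H)%g (S * K)%g L; rewrite -/u -/v.
rewrite ler_pdivlMr //.
move: c_le Nuv; have -> : ip u v = ip u0 v + ip (avg L u) v.
  by rewrite /u0 ipDl ipNl subrK.
rewrite !nrm_ind; move: (ip u0 v) (ip (avg L u) v) hu hv N0 L0 => c A.
have a0 := ler0n R #|(S * H)%g|; have b0 := ler0n R #|(S * K)%g|.
move: a0 b0; move: (#|(S * H)%g|%:R) (#|(S * K)%g|%:R) (#|S|%:R) (#|L|%:R).
move=> a b N l a0 b0 ha hb N0 l0 c_le NAc A_le.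
have d0 : 0 < dH * dK by rewrite mulr_gt0.
have ab_le : dH * dK * (a * b) <= N * N.
  by rewrite mulrACA ler_pM // mulr_ge0 // ltW.
(* The bound on [4 * eta] keeps the error below half of [#|S|], so the main term carries the other
   half. *)
have c_le' : 2 * c <= N.
  rewrite (le_trans (ler_norm _)) // -(ler_pXn2r (n := 2)) ?nnegrE ?(ltW N0) //.
  rewrite real_normK ?num_real // -(ler_pM2l d0).
  apply: (@le_trans _ _ (4 * eta * (dH * dK * (a * b)))).
    have := ler_wpM2l (ltW d0) c_le; lra.
  rewrite (le_trans (ler_wpM2l _ ab_le)) ?mulr_ge0 // expr2.
  by rewrite ler_wpM2r // mulr_ge0 // ltW.
rewrite -(ler_pM2r N0); apply: le_trans ab_le.
have NA : N / 2 <= A by lra.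
have : N / 2 * l <= a * b by apply: le_trans A_le; rewrite ler_pM2r.
by move=> /(ler_wpM2l (ltW d0)); lra.
Qed.

End Averages.

(** * Heisenberg triangles *)

Lemma fix_gen (gT : finGroupType) (T : eqType) (u : gT -> T) (A : {set gT}) :
    (forall g h, h \in A -> u (g * h)%g = u g) ->
  forall g h, h \in <<A>>%g -> u (g * h)%g = u g.
Proof.
move=> uA; pose stab := [set h | [forall g, u (g * h)%g == u g]].
have stab_group : group_set stab.
  apply/group_setP; split=> [|h k]; rewrite !inE.
    by apply/forallP => g; rewrite mulg1.
  move=> /forallP uh /forallP uk; apply/forallP => g.
  by rewrite mulgA (eqP (uk _)) uh.
have : A \subset group stab_group.
  by apply/subsetP => h /uA uh; rewrite inE; apply/forallP => g; rewrite uh.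
rewrite -gen_subG => /subsetP LS g h /LS.
by rewrite inE => /forallP/(_ g)/eqP.
Qed.

Section RootSubgroups.
Variables (F : finFieldType) (gT : finGroupType).
Implicit Types x y z : F -> gT.

Record embedding x := Embedding {
  embM : forall a b, x (a + b) = (x a * x b)%g;
  emb_inj : injective x
}.

Definition root_group x : {group gT} := <<[set x a | a in F]>>%G.

Lemma emb0 x : embedding x -> x 0 = 1%g.
Proof. by move=> xP; apply: (mulgI (x 0)); rewrite -(embM xP) addr0 mulg1. Qed.

Lemma root_groupE x : embedding x -> root_group x = [set x a | a in F] :> {set gT}.
Proof.
move=> xP; apply: gen_set_id; apply/group_setP; split.
  by apply/imsetP; exists 0; rewrite ?emb0.
by move=> _ _ /imsetP[a _ ->] /imsetP[b _ ->]; rewrite -(embM xP) imset_f.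
Qed.

Lemma mem_root_group x a : x a \in root_group x.
Proof. by apply/mem_gen/imset_f. Qed.

Lemma card_root_group x : embedding x -> #|root_group x| = #|F|.
Proof. by move=> xP; rewrite root_groupE // card_imset //; apply: emb_inj. Qed.

(** These are relations of the unitriangular 3 by 3 matrices over [F], with [z] parametrising the
    commutators. *)
Record heisenberg x y z := Heisenberg {
  heis_x : embedding x;
  heis_y : embedding y;
  heis_z : embedding z;
  heis_rel : forall a b, (y b * x a = x a * y b * z (a * b)%R)%g;
  heis_com : forall a b, (y b * z a = z a * y b)%g
}.

Variable R : realFieldType.
Local Notation V := {ffun gT -> R^o}.
Local Notation q := (#|F|%:R : R).

Lemma card_finField_gt0 : 0 < q.
Proof. by rewrite ltr0n; apply/card_gt0P; exists 0. Qed.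

Lemma avg_root x (f : V) g : embedding x ->
  avg (root_group x) f g = q^-1 * \sum_a (f (g * x a)%g : R).
Proof.
move=> xP; rewrite ffunE card_root_group // root_groupE //.
by rewrite big_imset //= => a b _ _; apply: emb_inj.
Qed.

Section Heisenberg.
Variables x y z : F -> gT.
Hypothesis xyz : heisenberg x y z.
Let xP := heis_x xyz.
Let yP := heis_y xyz.
Let zP := heis_z xyz.
Local Notation X := (root_group x).
Local Notation Y := (root_group y).
Local Notation Z := (root_group z).
Local Notation L := (X <*> Y)%G.

(* For [b != 0] the products [a * b] run over all of [F], so that summing over
   [a] averages over [Z]; only the terms with [b = 0] deviate from this. *)
Lemma avg_heis (f : V) :
  avg X (avg Y (avg X f)) =
  q^-1 *: (avg X f - avg X (avg Z f)) + avg X (avg Y (avg Z f)).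
Proof.
apply/ffunP => g; pose S s b c : R := f (g * x s * y b * z c)%g.
have q0 : q != 0 by rewrite gt_eqF ?card_finField_gt0.
have -> : avg X (avg Y (avg X f)) g =
    q^-1 ^+ 3 * \sum_b \sum_s \sum_a S s b (a * b).
  rewrite avg_root //; under eq_bigr => s _.
    rewrite avg_root //; under eq_bigr => b _ do rewrite avg_root //.
    rewrite -mulr_sumr; over.
  rewrite -!mulr_sumr !exprS expr0 mulr1 -!mulrA; do 3!congr (_ * _).
  rewrite exchange_big /=; apply: eq_bigr => b _.
  rewrite exchange_big /= [RHS]exchange_big /=; apply: eq_bigr => a _.
  rewrite [RHS](reindex_inj (addIr a)) /=; apply: eq_bigr => s _.
  by rewrite /S (embM xP) -!mulgA (heis_rel xyz) !mulgA.
have -> : (q^-1 *: (avg X f - avg X (avg Z f)) + avg X (avg Y (avg Z f))) g =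
  q^-1 * (q^-1 * (\sum_s S s 0 0) - q^-1 ^+ 2 * \sum_s \sum_c S s 0 c) +
  q^-1 ^+ 3 * \sum_b \sum_s \sum_c S s b c.
  have combE (u v w : V) :
      (q^-1 *: (u - v) + w) g = q^-1 * ((u g : R) - v g) + w g.
    by rewrite !ffunE.
  rewrite combE !avg_root //; congr (_ * (_ * _ - _) + _).
  - by apply: eq_bigr => s _; rewrite /S (emb0 yP) (emb0 zP) !mulg1.
  - under eq_bigr => s _ do rewrite avg_root //.
    rewrite -mulr_sumr mulrA -expr2; congr (_ * _).
    apply: eq_bigr => s _; apply: eq_bigr => c _.
    by rewrite /S (emb0 yP) mulg1.
  - under eq_bigr => s _.
      rewrite avg_root //; under eq_bigr => b _ do rewrite avg_root //.
      rewrite -mulr_sumr; over.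
    rewrite -!mulr_sumr !exprS expr0 mulr1 -!mulrA; do 3!congr (_ * _).
    by rewrite exchange_big.
rewrite (bigD1 0) //= [X in _ = _ + _ * X](bigD1 0) //=.
have -> : \sum_s \sum_a S s 0 (a * 0) = q * \sum_s S s 0 0.
  rewrite mulr_sumr; apply: eq_bigr => s _.
  under eq_bigr do rewrite mulr0.
  by rewrite sumr_const mulr_natl.
have -> : \sum_(b | b != 0) \sum_s \sum_a S s b (a * b) =
    \sum_(b | b != 0) \sum_s \sum_c S s b c.
  apply: eq_bigr => b b0; apply: eq_bigr => s _.
  by rewrite [RHS](reindex_inj (mulIf b0)).
by field.
Qed.

(** The left side is invariant under [X] by construction and under [Y] because moving [y b] past
    [x a] costs only an element of [Z], which the innermost average absorbs. Hence it is fixed by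
    [avg L], which in turn absorbs all three averages. *)
Lemma avg_heis_join (f : V) : avg X (avg Y (avg Z f)) = avg L f.
Proof.
have XL : X \subset L := joing_subl _ _.
have YL : Y \subset L := joing_subr _ _.
have ZL : Z \subset L.
  rewrite root_groupE //; apply/subsetP => _ /imsetP[c _ ->].
  have -> : z c = ((x c * y 1%R)^-1 * (y 1%R * x c))%g.
    by rewrite (heis_rel xyz) mulr1 mulKg.
  have xL : x c \in L by rewrite (subsetP XL) ?mem_root_group.
  have yL : y 1%R \in L by rewrite (subsetP YL) ?mem_root_group.
  by rewrite groupM ?groupV ?groupM.
rewrite -[RHS](avg_absorbr f ZL) -[RHS](avg_absorbr _ YL).
rewrite -[RHS](avg_absorbr _ XL); symmetry; set u := avg X _; apply: avg_fix.
apply: fix_gen => g h /setUP[]; first exact: avg_mulr.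
rewrite root_groupE // => /imsetP[b _ ->]; rewrite /u !avg_root //.
congr (_ * _); apply: eq_bigr => a _.
rewrite !avg_root //; congr (_ * _).
rewrite [RHS](reindex_inj (addrI b)) /=; apply: eq_bigr => b' _.
rewrite -!mulgA [(y b * _)%g]mulgA (heis_rel xyz) (embM yP) -!mulgA.
rewrite -(heis_com xyz) !mulgA avg_mulr ?mem_root_group //.
Qed.

(** For such [f] the norm of [avg Y f] is the quadratic form of [avg X], [avg Y], [avg X] composed,
    and [avg_heis] leaves [q^-1 * (nrm f - nrm (avg Z f))]. *)
Lemma heis_mixing : mixing X Y L q^-1.
Proof.
move=> f fX fL; have [XP YP ZP] := And3 (avg_proj R X) (avg_proj R Y) (avg_proj R Z).
have -> : nrm (avg Y f) = ip (avg X (avg Y (avg X f))) f.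
  by rewrite fX (proj_sym XP) fX /nrm (ip_proj YP) ipC.
rewrite avg_heis avg_heis_join fL addr0 ipZl ipDl ipNl !(proj_sym XP) fX.
rewrite ler_pM2l ?invr_gt0 ?card_finField_gt0 //.
by rewrite gerBl -(proj_id ZP) (proj_sym ZP) nrm_ge0.
Qed.

End Heisenberg.

Lemma triangle_mixing (x1 x2 x3 z12 z23 z31 : F -> gT) (r : R) :
    heisenberg x1 x2 z12 -> heisenberg x2 x3 z23 -> heisenberg x3 x1 z31 ->
    q = r ^+ 2 -> 2 <= r ->
    <<root_group x1 :|: root_group x2 :|: root_group x3>>%g = [set: gT] ->
  mixing (root_group x1 <*> root_group x2)%G (root_group x3) [set: gT]%G (2 / r).
Proof.
move=> h12 h23 h31 qr r2 gen.
have r0 : 0 < r by apply: lt_le_trans r2.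
have eps_bounds : 0 <= r^-1 <= 1.
  by rewrite invr_ge0 ltW //= invf_le1 // (le_trans _ r2) // ler1n.
have angle x y z : heisenberg x y z -> forall f,
    0 <= 2 * ip (f - avg (root_group x) f) (f - avg (root_group y) f) +
      r^-1 * (nrm (f - avg (root_group x) f) + nrm (f - avg (root_group y) f)).
  move=> xyz f.
  apply: (near_orthogonal_compl (s := avg (root_group x <*> root_group y)%G)) => //.
  - exact: avg_proj.
  - exact: avg_proj.
  - exact: avg_proj.
  - by move=> u; rewrite avg_absorb ?joing_subl.
  - by move=> u; rewrite avg_absorb ?joing_subr.
  by rewrite exprVn -qr; apply: heis_mixing xyz.
move=> f fL fT.
have [P1 P2 P3] := And3 (avg_proj R (root_group x1)) (avg_proj R (root_group x2))
                        (avg_proj R (root_group x3)).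
have sumf : \sum_g (f g : R) = 0.
  move/ffunP/(_ 1%g): fT; rewrite !ffunE => /eqP; rewrite mulf_eq0 invr_eq0.
  rewrite (negPf (card_group_neq0 _ [set: gT]%G)) /= => /eqP {2}<-.
  by apply: eq_big => g; rewrite ?inE // mul1g.
have f1 : avg (root_group x1) f = f by rewrite -fL avg_absorb ?joing_subl.
have f2 : avg (root_group x2) f = f by rewrite -fL avg_absorb ?joing_subr.
(* The kernel of the Laplacian consists of the constants, since the three root groups generate; [f]
   has sum zero and is orthogonal to them. *)
have [w wf] : exists w, laplacian (avg (root_group x1)) (avg (root_group x2))
                          (avg (root_group x3)) w = f.
  apply: laplacian_image => // v /(laplacian_eq0 P1 P2 P3)[v1 v2 v3].
  have vc g : v g = v 1%g.
    rewrite -[g in LHS]mul1g.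
    apply: (@fix_gen _ _ _ (root_group x1 :|: root_group x2 :|: root_group x3)).
      move=> k h /setUP[/setUP[]|] Hh; last exact: avg_fixP v3 Hh.
        exact: avg_fixP v1 Hh.
      exact: avg_fixP v2 Hh.
    by rewrite gen inE.
  rewrite /ip; under eq_bigr do rewrite vc.
  by rewrite -mulr_suml sumf mul0r.
apply: (image_gap P1 P2 P3 _ (angle _ _ _ h12) (angle _ _ _ h23)
         (angle _ _ _ h31) wf f1 f2).
by rewrite ler_pdivrMr // mul1r.
Qed.

(** [mixing_dense] is applied twice, first inside the group generated by the first two root groups
    with [eta = q^-1], then in the whole group with [eta = 2 / r]. *)
Lemma triangle_dense (x1 x2 x3 z12 z23 z31 : F -> gT) (r delta : R) S :
    heisenberg x1 x2 z12 -> heisenberg x2 x3 z23 -> heisenberg x3 x1 z31 ->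
    q = r ^+ 2 -> 2 <= r ->
    <<root_group x1 :|: root_group x2 :|: root_group x3>>%g = [set: gT] ->
    0 < delta -> 4 / r ^+ 2 <= delta * delta ->
    4 * (2 / r) <= delta * delta / 2 * delta ->
    dense S (root_group x1) delta -> dense S (root_group x2) delta ->
    dense S (root_group x3) delta ->
  dense S [set: gT]%G (delta * delta / 2 * delta / 2).
Proof.
move=> h12 h23 h31 qr r2 gen d0 hd2 hd3 S1 S2 S3.
have r0 : 0 < r by apply: lt_le_trans r2.
have mix12 := heis_mixing h12.
have mix := triangle_mixing h12 h23 h31 qr r2 gen.
apply: (mixing_dense _ _ mix) => //; rewrite ?subsetT // ?divr_ge0 ?ltW //.
  by rewrite divr_gt0 ?mulr_gt0.
apply: (mixing_dense _ _ mix12) => //; rewrite ?joing_subl ?joing_subr //.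
  by rewrite invr_ge0 ltW ?card_finField_gt0.
by rewrite qr.
Qed.

End RootSubgroups.

(** * BCH constraints on cosets *)

Section Perp.
Variable X : finType.
Implicit Types (y c : word X) (H : {set word X}).

Lemma dot_linear y : linear (dot y : word X -> ('F_2)^o).
Proof. by move=> a u v; rewrite -[dot y _]/(ip y _) ipDr ipZr. Qed.

HB.instance Definition _ y :=
  GRing.isLinear.Build 'F_2 (word X) ('F_2)^o *:%R (dot y) (dot_linear y).

Definition perp H : {vspace word X} :=
  (\bigcap_(y in H) lker (linfun (dot y : word X -> ('F_2)^o)))%VS.

Lemma perpP H c : reflect (forall y, y \in H -> dot y c = 0) (c \in perp H).
Proof.
rewrite memvE; apply: (iffP subv_bigcapP) => cH y /cH.
  by rewrite -memvE memv_ker lfunE => /eqP.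
by move=> yc; rewrite -memvE memv_ker lfunE /= yc.
Qed.

Lemma perp_constraints H : defining_constraints (perp H) H.
Proof.
apply/setP => y; rewrite !inE; apply/idP/forall_inP => [yH c /perpP cH|yP].
  have /subvP/(_ y yH) : (<<enum H>> <= lker (linfun (dot c : _ -> ('F_2)^o)))%VS.
    apply/span_subvP => h; rewrite mem_enum => /cH hc.
    by rewrite memv_ker lfunE /= -[dot c h]/(ip c h) ipC [ip h c]hc.
  by rewrite memv_ker lfunE /= -[dot c y]/(ip c y) ipC.
apply: span_perp => v vH; apply/eqP/yP/perpP => h Hh; apply: vH.
by rewrite mem_enum.
Qed.

Lemma dim_perp H : (#|X| <= \dim (perp H) + #|H|)%N.
Proof.
have -> : #|X| = \dim {:word X} by rewrite dimvf /= /dim /= muln1.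
rewrite /perp -big_enum cardE /=; elim: (enum H) => [|y s IHs].
  by rewrite big_nil addn0.
rewrite big_cons /= capvC addnS -addSn.
apply: leq_trans IHs _; rewrite leq_add2r.
rewrite -(limg_ker_dim (linfun (dot y : word X -> ('F_2)^o))).
rewrite -[X in (_ <= X)%N]addn1 leq_add2l.
by rewrite (leq_trans (dimvS (subvf _))) // dimvf.
Qed.

End Perp.

Lemma F2_neq0 (a : 'F_2) : a != 0 -> a = 1.
Proof. by case: a => [[|[|//]] lt2] // _; apply/val_inj. Qed.

Section BCHTanner.
Variables (F : finFieldType) (gT : finGroupType) (I : finType).
Variables (x : I -> F -> gT) (m d : nat) (phi : F -> 'rV['F_2]_m).
Hypotheses (xP : forall i, embedding (x i)).
Hypotheses (phiD : {morph phi : a b / a + b}) (phi_inj : injective phi).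
Implicit Types c : word gT.

(** One ['F_2]-coordinate of the [j]-th power sum syndrome on a coset. The exponent [j = 0] is the
    parity check that extends the BCH code. *)
Definition check i g (j : 'I_d) (k : 'I_m) : word gT :=
  [ffun h => \sum_(a | (g * x i a)%g == h) phi (a ^+ j) 0 k].

Definition checks : {set word gT} :=
  [set check u.1.1.1 u.1.1.2 u.1.2 u.2 | u in {: I * gT * 'I_d * 'I_m}].

Definition restr i g c : {set F} := [set a | c (g * x i a)%g != 0].

Lemma phi0 : phi 0 = 0.
Proof. by apply: (addrI (phi 0)); rewrite -phiD !addr0. Qed.

Lemma dot_check i g j k c :
  dot (check i g j k) c = phi (\sum_(a in restr i g c) a ^+ j) 0 k.
Proof.
rewrite (big_morph phi phiD phi0) summxE.
transitivity (\sum_a phi (a ^+ j) 0 k * c (g * x i a)%g).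
  rewrite (partition_big (fun a => (g * x i a)%g) xpredT) //=.
  by apply: eq_bigr => h _; rewrite ffunE mulr_suml; apply: eq_bigr => a /eqP->.
rewrite [RHS]big_mkcond; apply: eq_bigr => a _; rewrite inE.
by case: eqVneq => [->|/F2_neq0->]; rewrite ?mulr0 ?mulr1.
Qed.

(** Polynomials replace the powers [a ^+ j] because their degree bound is stable under translation
    of the argument, hence under change of base point in the coset. *)
Definition syndrome_free i g c :=
  forall p : {poly F}, (size p <= d)%N -> \sum_(a in restr i g c) p.[a] = 0.

Lemma syndrome_freeP i g c :
  (forall j k, dot (check i g j k) c = 0) <-> syndrome_free i g c.
Proof.
split=> [cP p sp|cP j k]; last first.
  rewrite dot_check; under eq_bigr => a _ do rewrite -hornerXn.
  by rewrite cP ?size_polyXn // phi0 mxE.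
under eq_bigr => a _ do rewrite (horner_coef_wide _ sp).
rewrite exchange_big big1 // => j _; rewrite -mulr_sumr.
suff -> : \sum_(a in restr i g c) a ^+ j = 0 by rewrite mulr0.
apply: phi_inj; apply/rowP => k; by rewrite -dot_check cP phi0 mxE.
Qed.

Lemma syndrome_free_shift i g h c : h \in root_group (x i) ->
  syndrome_free i (g * h)%g c -> syndrome_free i g c.
Proof.
rewrite root_groupE // => /imsetP[b _ ->] cP p sp.
rewrite -[RHS](cP (p \Po ('X + b%:P))); last first.
  by rewrite size_comp_poly2 // size_XaddC.
rewrite [LHS](reindex_inj (addrI b)) /=; apply: eq_big => a.
  by rewrite !inE (embM (xP i)) mulgA.
by rewrite horner_comp !hornerE addrC.
Qed.

Lemma mem_tanner c :
  reflect (forall i g, syndrome_free i g c) (c \in perp checks).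
Proof.
apply: (iffP (perpP _ _)) => [cP i g|cP _ /imsetP[[[[i g] j] k] _ ->]].
  by apply/syndrome_freeP => j k; apply: cP; apply/imsetP; exists (i, g, j, k).
by have /syndrome_freeP-> := cP i g.
Qed.

(** With fewer than [d] points in the support, the polynomial vanishing at all of them except [0] is
    short enough to be a check, yet its sum over the support is its nonzero value at [0]. *)
Lemma tanner_restr_card c i g : c \in perp checks -> c g != 0 ->
  (d <= #|restr i g c|)%N.
Proof.
move=> /mem_tanner/(_ i g) cP cg; rewrite leqNgt; apply/negP => lt_d.
have S0 : 0 \in restr i g c by rewrite inE emb0 // mulg1.
pose p := \prod_(b in restr i g c :\ 0) ('X - b%:P).
have := cP p; rewrite (bigD1 0) //= big1; last first.
  move=> a /andP[Sa a0]; rewrite horner_prod (bigD1 a) ?inE ?a0 //=.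
    by rewrite !hornerE subrr mul0r.
  by move: Sa; rewrite inE.
rewrite addr0 => p0; suff /eqP : p.[0] != 0.
  apply; apply: p0; rewrite /p -big_enum size_prod_XsubC -cardE.
  by move/ltnW: lt_d; rewrite (cardsD1 0) S0.
rewrite horner_prod prodf_seq_neq0; apply/allP => b _; apply/implyP.
by rewrite !inE !hornerE oppr_eq0 => /andP[].
Qed.

Lemma tanner_dense (R : realFieldType) c i : c \in perp checks ->
  dense [set g | c g != 0] (root_group (x i)) (d%:R / #|F|%:R : R).
Proof.
move=> cP g; rewrite inE => cg; rewrite card_root_group // divfK; last first.
  by rewrite gt_eqF ?card_finField_gt0.
rewrite ler_nat (leq_trans (tanner_restr_card i cP cg)) //.
rewrite -(card_imset _ (inj_comp (mulgI g) (emb_inj (xP i)))).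
apply/subset_leq_card/subsetP => _ /imsetP[a Sa ->].
by rewrite inE inE /= mem_lcoset mulKg mem_root_group andbT; move: Sa; rewrite inE.
Qed.

Lemma weight_check y : y \in checks -> (weight y <= #|F|)%N.
Proof.
move=> /imsetP[[[[i g] j] k] _ ->] /=.
apply: leq_trans (leq_imset_card (fun a => g * x i a)%g F).
apply/subset_leq_card/subsetP => h; rewrite inE ffunE; apply: contraR => hN.
rewrite big1 // => a /eqP ga; case/imsetP: hN; by exists a.
Qed.

(** By [syndrome_free_shift] the checks at one base point per coset define the same code, which
    divides their number by [#|F|]. *)
Lemma dim_tanner :
  (#|gT| * #|F| <= \dim (perp checks) * #|F| + #|I| * d * m * #|gT|)%N.
Proof.
pose reps i := lcosets (root_group (x i)) [set: gT].
pose D := \bigcup_(i : I) [set check i (repr u.1.1) u.1.2 u.2 | u in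
   setX (setX (reps i) [set: 'I_d]) [set: 'I_m]].
have sDC : (perp D <= perp checks)%VS.
  apply/subvP => c /perpP cD; apply/mem_tanner => i g.
  have gi := mem_repr _ (lcoset_refl (root_group (x i)) g).
  rewrite mem_lcoset in gi.
  apply: (syndrome_free_shift gi); rewrite mulKVg; apply/syndrome_freeP => j k.
  apply: cD; apply/bigcupP; exists i => //; apply/imsetP.
  exists ((g *: root_group (x i))%g, j, k) => //.
  by rewrite !inE !andbT; apply/lcosetsP; exists g; rewrite ?inE.
have cD : (#|D| * #|F| <= #|I| * d * m * #|gT|)%N.
  apply: (@leq_trans ((\sum_(i : I) #|reps i| * (d * m)) * #|F|)).
    rewrite leq_mul2r; apply/orP; right.
    apply: (@big_ind2 _ _ (fun (A : {set word gT}) n => #|A| <= n)%N).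
    - by rewrite cards0.
    - by move=> A n B k An Bk; rewrite (leq_trans (leq_card_setU _ _)) ?leq_add.
    move=> i _; rewrite (leq_trans (leq_imset_card _ _)) //.
    by rewrite !cardsX !cardsT !card_ord mulnA.
  rewrite big_distrl /= -!mulnA -sum_nat_const leq_sum // => i _.
  rewrite card_lcosets -(card_root_group (xP i)) mulnC !mulnA -cardsT.
  by rewrite Lagrange ?subsetT // -mulnA mulnC.
apply: leq_trans (leq_mul (dim_perp D) (leqnn _)) _.
by rewrite mulnDl leq_add // leq_mul2r dimvS ?orbT.
Qed.

(** Left translation permutes the left cosets together with their parametrisations; the inverse
    makes it a right action. *)
Lemma tanner_symmetric : simply_symmetric (perp checks).
Proof.
have act1 : (fun h g : gT => g^-1 * h)%g^~ 1%g =1 id.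
  by move=> h; rewrite /= invg1 mul1g.
have actM h : act_morph (fun h g : gT => g^-1 * h)%g h.
  by move=> a b; rewrite invMg mulgA.
exists gT, (TotalAction act1 actM); split; first split.
- apply/imsetP; exists 1%g; rewrite ?inE //; apply/setP => h; rewrite inE.
  by apply/esym/imsetP; exists h^-1%g; rewrite ?inE //= invgK mulg1.
- move=> h; apply/trivgP/subsetP => g; rewrite !inE /= => /subsetP/(_ h).
  rewrite !inE eqxx => /(_ isT)/eqP/= e.
  by rewrite -(inj_eq invg_inj) invg1 -(inj_eq (mulIg h)) e mul1g.
move=> g c /mem_tanner cP; apply/mem_tanner => i h p sp.
rewrite -[RHS](cP i (g * h)%g p sp); apply: eq_bigl => a.
by rewrite !inE ffunE /= invgK mulgA.
Qed.

End BCHTanner.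

(** * A family of Heisenberg triangles *)

Section Elementary.
Variables (F : finFieldType) (n : nat).
Local Notation V := 'rV[F]_n.+2.
Local Notation W := {ffun 'I_3 -> V}.
Implicit Types (i j k : 'I_3) (T S : V -> V).

(** The elementary matrix with block [T] in position [(i, j)], acting on columns of three
    vectors. *)
Definition elem_fun i j T (w : W) : W :=
  [ffun l => if l == i then w i + T (w j) else w l].

Lemma elem_fun_inj i j T : i != j -> injective (elem_fun i j T).
Proof.
move=> ij; apply: (can_inj (g := elem_fun i j (fun v => - T v))) => w.
apply/ffunP => l; rewrite !ffunE eqxx [j == i]eq_sym (negPf ij).
by case: eqP => [->|//]; rewrite addrK.
Qed.

Definition elem i j (ij : i != j) T : {perm W} := perm (@elem_fun_inj i j T ij).

Lemma eq_elem i j i' j' (ij : i != j) (ij' : i' != j') T S :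
  i = i' -> j = j' -> T =1 S -> elem ij T = elem ij' S.
Proof.
move=> ei ej eqTS; case: i' / ei ij'; case: j' / ej => ij'.
by apply/permP => w; apply/ffunP => l; rewrite !permE !ffunE eqTS.
Qed.

Lemma elemD i j (ij : i != j) T S :
  elem ij (fun v => T v + S v) = (elem ij T * elem ij S)%g.
Proof.
apply/permP => w; apply/ffunP => l; rewrite permM !permE !ffunE eqxx.
by rewrite [j == i]eq_sym (negPf ij); case: eqP => // _; rewrite addrA.
Qed.

(** The left factor of a product of permutations acts first, so on the left side [T] sees the
    coordinate already changed by [S]; this is the source of [T \o S]. *)
Lemma elem_rel i j k (ij : i != j) (jk : j != k) (ik : i != k) T S :
    {morph T : u v / u + v} ->
  (elem jk S * elem ij T = elem ij T * elem jk S * elem ik (T \o S))%g.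
Proof.
move=> TD; apply/permP => w; apply/ffunP => l; rewrite !permM !permE !ffunE !eqxx.
rewrite [j == i]eq_sym [k == j]eq_sym [k == i]eq_sym.
rewrite (negPf ij) (negPf jk) (negPf ik).
case: (eqVneq l i) => [_|_]; first by rewrite TD addrA.
by case: (eqVneq l j).
Qed.

Lemma elem_com i j k (jk : j != k) (ik : i != k) T S : i != j ->
  (elem jk S * elem ik T = elem ik T * elem jk S)%g.
Proof.
move=> ij; apply/permP => w; apply/ffunP => l; rewrite !permM !permE !ffunE.
rewrite [j == i]eq_sym [k == j]eq_sym [k == i]eq_sym.
rewrite (negPf ij) (negPf jk) (negPf ik).
case: (eqVneq l i) => [->|_]; first by rewrite (negPf ij).
by case: (eqVneq l j).
Qed.

Lemma elem_inj i j (ij : i != j) T S : elem ij T = elem ij S -> T =1 S.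
Proof.
move=> eqTS v; have := congr1 (fun s : {perm W} => s [ffun=> v] i) eqTS.
by rewrite !permE !ffunE eqxx => /addrI.
Qed.

Definition root_elem i j (ij : i != j) T (a : F) := elem ij (fun v => a *: T v).

Lemma root_elem_emb i j (ij : i != j) T v : T v != 0 -> embedding (root_elem ij T).
Proof.
move=> Tv; split=> [a b|a b /elem_inj/(_ v)/eqP].
  by rewrite -elemD; apply: eq_elem => // u; rewrite scalerDl.
by rewrite -subr_eq0 -scalerBl scaler_eq0 (negPf Tv) orbF subr_eq0 => /eqP.
Qed.

Lemma root_elem_heis i j k (ij : i != j) (jk : j != k) (ik : i != k)
    (T S : {linear V -> V}) v : T v = v -> S v = v -> v != 0 ->
  heisenberg (root_elem ij T) (root_elem jk S) (root_elem ik (T \o S)).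
Proof.
move=> Tv Sv v0; split.
- by apply: (@root_elem_emb _ _ _ _ v); rewrite Tv.
- by apply: (@root_elem_emb _ _ _ _ v); rewrite Sv.
- by apply: (@root_elem_emb _ _ _ _ v); rewrite /= Sv Tv.
- move=> a b; rewrite (elem_rel ij jk ik) => [|u w]; last by rewrite linearD scalerDr.
  by congr (_ * _)%g; apply: eq_elem => // u /=; rewrite linearZ scalerA.
by move=> a b; apply: elem_com.
Qed.

Definition shift (v : V) : V := \row_l v 0 (l + 1).

Lemma shift_linear : linear shift.
Proof. by move=> a u v; apply/rowP => l; rewrite !mxE. Qed.

HB.instance Definition _ := GRing.isLinear.Build F V V *:%R shift shift_linear.

Lemma iter_shift (k : nat) (v : V) l : iter k shift v 0 l = v 0 (l + k%:R).
Proof.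
elim: k l => [|k IHk] l; first by rewrite addr0.
by rewrite iterS mxE IHk -addrA -natr1 [1 + _]addrC.
Qed.

Lemma ord3_neq1 i : i != i + 1. Proof. by case: i => [[|[|[|//]]] ?]. Qed.
Lemma ord3_neq2 i : i != i + 1 + 1. Proof. by case: i => [[|[|[|//]]] ?]. Qed.

Lemma ord3P i : i = 0 \/ i = 1 \/ i = 2.
Proof.
by case: i => [[|[|[|//]]] ?]; [left|right; left|right; right]; apply/val_inj.
Qed.

(** Only position [(2, 0)] carries the cyclic shift, so each tour of the triangle contributes one
    power of it. This makes the group grow with [n] while [F] stays fixed. *)
Definition twist i : {linear V -> V} :=
  if i == 2 then (shift : {linear V -> V}) else (idfun : {linear V -> V}).

Definition triangle_root i := root_elem (ord3_neq1 i) (twist i).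

Definition triangle_comm i := root_elem (ord3_neq2 i) (twist i \o twist (i + 1)).

Lemma triangle_heis i :
  heisenberg (triangle_root i) (triangle_root (i + 1)) (triangle_comm i).
Proof.
(* The all-ones vector is fixed by every twist and witnesses injectivity of the root elements. *)
have tw j : twist j (const_mx 1) = const_mx 1.
  by rewrite /twist; case: eqP => //= _; apply/rowP => l; rewrite !mxE.
apply: (root_elem_heis _ _ _ (tw i) (tw (i + 1))).
by apply/eqP => /rowP/(_ 0); rewrite !mxE => /eqP; rewrite oner_eq0.
Qed.

Definition triangle_group : {group {perm W}} :=
  <<\bigcup_i [set triangle_root i a | a in F]>>%G.

Lemma mem_triangle_root i a : triangle_root i a \in triangle_group.
Proof. by apply/mem_gen/bigcupP; exists i => //; apply: imset_f. Qed.

Lemma mem_elem_comp i j k (ij : i != j) (jk : j != k) (ik : i != k) T S :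
    {morph T : u v / u + v} -> elem ij T \in triangle_group ->
    elem jk S \in triangle_group ->
  elem ik (T \o S) \in triangle_group.
Proof.
move=> TD TG SG.
have -> : elem ik (T \o S) =
    ((elem ij T * elem jk S)^-1 * (elem jk S * elem ij T))%g.
  by rewrite (elem_rel ij jk ik) // mulKg.
by rewrite groupM ?groupV ?groupM.
Qed.

Lemma iter_shiftD (k : nat) : {morph iter k shift : u v / u + v}.
Proof. by elim: k => [|k IHk] u v //; rewrite !iterS IHk linearD. Qed.

(** Commutators lead from position [(0, 1)] to [(0, 2)] through [g12] and back to [(0, 1)] through
    [g21], gaining one shift. *)
Lemma mem_elem_iter (k : nat) (e01 : 0 != 1 :> 'I_3) :
  elem e01 (iter k shift) \in triangle_group.
Proof.
have e12 : 1 != 2 :> 'I_3 by [].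
have e20 : 2 != 0 :> 'I_3 by [].
have e02 : 0 != 2 :> 'I_3 by [].
have e21 : 2 != 1 :> 'I_3 by [].
have rootE i j (ij : i != j) : j = i + 1 -> elem ij (twist i) \in triangle_group.
  move=> ej; rewrite (_ : elem ij _ = triangle_root i 1) ?mem_triangle_root //.
  by apply: eq_elem => // v; rewrite scale1r.
have g01 : elem e01 id \in triangle_group by apply: rootE; apply/val_inj.
have g12 : elem e12 id \in triangle_group by apply: rootE; apply/val_inj.
have g20 : elem e20 shift \in triangle_group by apply: rootE; apply/val_inj.
have g21 : elem e21 shift \in triangle_group.
  by apply: (mem_elem_comp e21 _ g20 g01); apply: linearD.
elim: k => [//|k IHk].
have g02 := mem_elem_comp e02 (@iter_shiftD k) IHk g12.
have := mem_elem_comp e01 (@iter_shiftD k) g02 g21.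
rewrite (eq_elem e01 e01 (S := iter k.+1 shift)) // => v.
by rewrite iterSr.
Qed.

Lemma card_triangle_group : (n <= #|triangle_group|)%N.
Proof.
have e01 : 0 != 1 :> 'I_3 by [].
pose f (k : 'I_n.+2) := elem e01 (iter k shift).
have f_inj : injective f.
  move=> k l /elem_inj/(_ (delta_mx 0 0))/rowP/(_ (- k%:R)).
  rewrite !iter_shift !mxE addNr !eqxx /=.
  case: eqP => [e _|_ /eqP]; last by rewrite oner_eq0.
  by move/eqP: e; rewrite addrC subr_eq0 !natr_Zp => /eqP.
apply: (@leq_trans #|'I_n.+2|); first by rewrite card_ord ltnW // ltnW.
rewrite -(card_imset _ f_inj) subset_leq_card //.
by apply/subsetP => _ /imsetP[k _ ->]; apply: mem_elem_iter.
Qed.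

(** Passing to the subgroup as a group type of its own makes the root groups generate everything. *)
Lemma triangle_exists :
  {gT : finGroupType & {x : 'I_3 -> F -> gT & {z : 'I_3 -> F -> gT |
  [/\ forall i, heisenberg (x i) (x (i + 1)) (z i),
      <<root_group (x 0%R) :|: root_group (x 1%R) :|: root_group (x 2%R)>>%g = [set: gT]
    & (n <= #|gT|)%N]}}}.
Proof.
set G := triangle_group.
have zG i a : triangle_comm i a \in G.
  have -> : triangle_comm i a =
    ((triangle_root i a * triangle_root (i + 1)%R 1%R)^-1 *
      (triangle_root (i + 1)%R 1%R * triangle_root i a))%g.
    by rewrite (heis_rel (triangle_heis i)) mulr1 mulKg.
  by rewrite groupM ?groupV ?groupM ?mem_triangle_root.
have sub_emb (x : F -> {perm W}) : (forall a, x a \in G) -> embedding x ->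
    embedding (fun a => subg G (x a)).
  move=> xG xP; split=> [a b|a b /(congr1 sgval)].
    by rewrite (embM xP) subgM.
  by rewrite !subgK // => /(emb_inj xP).
pose x i a := subg G (triangle_root i a).
pose z i a := subg G (triangle_comm i a).
exists (subg_of G), x, z; split=> [i||].
- have xG := mem_triangle_root; have [xP yP zP rel com] := triangle_heis i.
  split; try by apply: sub_emb.
    by move=> a b; rewrite /x /z -!subgM ?groupM // rel.
  by move=> a b; rewrite /x /z -!subgM // com.
- set K := <<_>>%g; apply/eqP; rewrite eqEsubset subsetT /=.
  have GK : G \subset (sgval @* K)%g.
    rewrite gen_subG; apply/bigcupsP => i _; apply/subsetP => _ /imsetP[a _ ->].
    rewrite -[triangle_root i a](@subgK _ G _ (mem_triangle_root i a)).
    apply: mem_morphim; rewrite ?inE //; apply: mem_gen.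
    have mx j : x j a \in root_group (x j) := mem_root_group _ _.
    rewrite -[subg G _]/(x i a) 2!in_setU.
    by have [->|[->|->]] := ord3P i; rewrite mx ?orbT.
  apply/subsetP => u _.
  have /morphimP[v _ Kv /val_inj -> //] := subsetP GK _ (subgP u).
by rewrite card_sub card_triangle_group.
Qed.

End Elementary.

(** * Choice of parameters and assembly of the family *)

Lemma F2_coordinates m : (0 < m)%N ->
  exists (F : finFieldType) (phi : F -> 'rV['F_2]_m),
    [/\ {morph phi : a b / a + b}, injective phi & #|F| = (2 ^ m)%N].
Proof.
move=> m0; have [F pF cF] := pPrimePowerField (isT : prime 2) m0.
exists F; have [/= phi phiP /bij_inj phi_inj] := pprimeChar_vectAxiom pF.
have em : logn 2 #|F| = m by rewrite cF pfactorK.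
rewrite -[m]em; exists phi; split; [|exact: phi_inj|by rewrite em].
by move=> a b; have := phiP 1 a b; rewrite !scale1r.
Qed.

(** The bound [k <= 1] takes care of the default value [#|X|] of the minimum. *)
Lemma min_weight_ge (X : finType) (C : {vspace word X}) (k : rat) :
    k <= 1 ->
    (forall c, c \in C -> c != 0 -> k * #|X|%:R <= (weight c)%:R) ->
  k * #|X|%:R <= (min_weight C)%:R.
Proof.
move=> k1 kC; rewrite /min_weight.
elim/big_ind: _ => [|a b ka kb|c /andP[]]; last exact: kC.
  by rewrite ler_piMl.
by rewrite /minn; case: ifP.
Qed.
(** The local density is [d / #|F| = 1 / k]. The checks use up at most a fraction [3 * m / k] of the
    dimension, which [6 * m <= k] makes at most one half, and [16 * k ^ 3 <= r] is the condition of
    the second mixing step. *)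
Lemma good_code (F : finFieldType) (m : nat) (phi : F -> 'rV['F_2]_m)
    (k d r : nat) (n : nat) :
    {morph phi : a b / a + b} -> injective phi ->
    #|F| = (k * d)%N -> #|F| = (r ^ 2)%N -> (0 < k)%N ->
    (6 * m <= k)%N -> (16 * k ^ 3 <= r)%N ->
  {C : code | [/\ (n <= code_length C)%N, 2^-1 <= rate C,
    (4 * k%:R ^+ 3)^-1 <= normalized_distance C,
    forall y, y \in constraints C -> (weight y <= #|F|)%N
    & simply_symmetric C]}.
Proof.
move=> phiD phi_inj qkd qr k0 mk kr.
have [gT [x [z [heis gen ngT]]]] := triangle_exists F n.
have xP i : embedding (x i) := heis_x (heis i).
pose H := checks x d phi.
have gT0 : (0 < #|gT|)%N by apply/card_gt0P; exists 1%g.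
have gT0' : 0 < #|gT|%:R :> rat by rewrite ltr0n.
have q0 : (0 < #|F|)%N by apply/card_gt0P; exists 0.
have d0 : (0 < d)%N by move: q0; rewrite qkd muln_gt0 => /andP[].
exists (Code (perp_constraints H)); split => //=.
- rewrite /rate /= ler_pdivlMr // ler_pdivrMl // -natrM ler_nat.
  have := dim_tanner d xP phiD phi_inj; rewrite -/H card_ord qkd => dimH.
  have kd0 : (0 < k * d)%N by rewrite muln_gt0 k0.
  rewrite -(leq_pmul2r kd0).
  have : (6 * m * (d * #|gT|) <= k * (d * #|gT|))%N by rewrite leq_mul2r mk orbT.
  by move: dimH; move: (\dim _) #|gT|; nia.
- rewrite /normalized_distance ler_pdivlMr //; apply: min_weight_ge.
    rewrite invf_le1; last by rewrite mulr_gt0 // exprn_gt0 // ltr0n.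
    by rewrite -natrX -natrM ler1n muln_gt0 expn_gt0 k0.
  move=> c cC c0.
  have [g cg] : exists g, c g != 0.
    apply/existsP; apply: contraNT c0 => /existsPn c0; apply/eqP/ffunP => g.
    by rewrite ffunE; apply/eqP; rewrite -[_ == _]negbK c0.
  have k0' : 0 < k%:R :> rat by rewrite ltr0n.
  have dens i : dense [set g | c g != 0] (root_group (x i)) (k%:R^-1 : rat).
    rewrite (_ : _^-1 = d%:R / #|F|%:R); first exact: tanner_dense.
    by rewrite qkd natrM invfM mulrCA divff ?mulr1 // pnatr_eq0 -lt0n.
  have kr' : 16 * k%:R ^+ 3 <= r%:R :> rat by rewrite -natrX -natrM ler_nat.
  have k1 : 1 <= k%:R :> rat by rewrite ler1n.
  have k2 : 1 <= k%:R ^+ 2 :> rat by rewrite exprn_ege1.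
  have k3 : k%:R <= k%:R ^+ 3 :> rat by rewrite exprS ler_peMr // ltW.
  have r0 : 0 < r%:R :> rat by lra.
  have e01 : (0 + 1 = 1 :> 'I_3) by apply/val_inj.
  have e12 : (1 + 1 = 2 :> 'I_3) by apply/val_inj.
  have e20 : (2 + 1 = 0 :> 'I_3) by apply/val_inj.
  have h01 := heis 0; have h12 := heis 1; have h20 := heis 2.
  rewrite e01 in h01; rewrite e12 in h12; rewrite e20 in h20.
  have := @triangle_dense _ _ rat _ _ _ _ _ _ r%:R k%:R^-1 [set g | c g != 0]
            h01 h12 h20 _ _ gen _ _ _ (dens 0) (dens 1) (dens 2).
  have -> : k%:R^-1 * k%:R^-1 / 2 * k%:R^-1 / 2 = (4 * k%:R ^+ 3)^-1 :> rat.
    by field; rewrite gt_eqF.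
  move=> dT.
  have {}dT : dense [set g | c g != 0] [set: gT]%G ((4 * k%:R ^+ 3)^-1 : rat).
    refine (dT _ _ _ _ _).
    - by rewrite qr natrX.
    - by lra.
    - by rewrite invr_gt0.
    - rewrite -invfM -expr2 ler_pdivrMr ?exprn_gt0 // ler_pdivlMl ?exprn_gt0 //.
      have -> : k%:R ^+ 2 * 4 = (2 * k%:R) ^+ 2 :> rat by ring.
      by rewrite ler_pXn2r ?nnegrE ?mulr_ge0 ?(ltW r0) //; lra.
    - have -> : k%:R^-1 * k%:R^-1 / 2 / k%:R = (2 * k%:R ^+ 3)^-1 :> rat.
        by field; rewrite gt_eqF.
      rewrite mulrA ler_pdivrMr // ler_pdivlMl ?mulr_gt0 ?exprn_gt0 //; lra.
  have := dT g; rewrite inE cg cardsT => /(_ isT) /le_trans; apply.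
  by rewrite ler_nat subset_leq_card // subsetIl.
- by move=> y; apply: weight_check.
exact: tanner_symmetric.
Qed.

Theorem theorem2 :
  exists F : nat -> code,
    [/\ asymptotically_good F, LDPC F & forall n : nat, simply_symmetric (F n)].
Proof.
have [m [k [d [r [m0 [qkd qr] k0 [mk kr]]]]]] : exists m k d r,
    [/\ (0 < m)%N, (2 ^ m = k * d)%N /\ (2 ^ m = r ^ 2)%N, (0 < k)%N
      & (6 * m <= k)%N /\ (16 * k ^ 3 <= r)%N].
  (* The two inequalities read [384 <= 512] and [2 ^ 31 <= 2 ^ 32]. *)
  exists 64, (2 ^ 9)%N, (2 ^ 55)%N, (2 ^ 32)%N; split; last split.
  - by [].
  - by split; [rewrite -expnD | rewrite -expnM].
  - by rewrite expn_gt0.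
  - by [].
  by rewrite -expnM -[16%N]/(2 ^ 4)%N -expnD leq_exp2l.
have [F [phi [phiD phi_inj cF]]] := F2_coordinates m0.
rewrite -cF in qkd qr.
pose C n := good_code n phiD phi_inj qkd qr k0 mk kr.
exists (fun n => sval (C n)); split=> [|| n]; last by case: (svalP (C n)).
  split=> [N|].
    by exists N => n Nn; case: (svalP (C n)) => /(leq_trans Nn).
  exists (4 * k%:R ^+ 3)^-1; first by rewrite invr_gt0 mulr_gt0 ?exprn_gt0 ?ltr0n.
  move=> n; case: (svalP (C n)) => _ rC dC _ _; split=> //.
  apply: le_trans rC; rewrite lef_pV2 ?posrE ?mulr_gt0 ?exprn_gt0 ?ltr0n //.
  have : 1 <= k%:R ^+ 3 :> rat by rewrite exprn_ege1 // ler1n.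
  lra.
by exists #|F| => n; case: (svalP (C n)).
Qed.
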